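(* Let $G$ be a finite group and $k$ an algebraically closed field of characteristic zero. The fusion subcategories of the representation category $\operatorname{Rep}(D(G))$ of the Drinfeld double $D(G)$ are in bijection with the triples $(K,H,B)$, where $K,H$ are normal subgroups of $G$ centralizing each other and $B: K\times H\to k^\times$ is a $G$-invariant bicharacter.
   Context: $D(G)$ is the Drinfeld (quantum) double over $k$ of the group algebra $kG$; $\operatorname{Rep}(D(G))$ is the category of finite-dimensional $D(G)$-modules, a braided (in fact modular) fusion category, equivalent as a braided fusion category to the category of $G$-equivariant vector bundles on $G$, where $G$ acts on itself by conjugation. A fusion subcategory is a full subcategory, closed under isomorphism, that contains the unit object and is closed under finite direct sums, direct summands, tensor products and duals. Subgroups $K,H$ centralize each other if $kh=hk$ for all $k\in K$, $h\in H$. A bicharacter on $K\times H$ is a map $B:K\times H\to k^\times$ that is multiplicative in each argument; it is $G$-invariant if $B(xkx^{-1},xhx^{-1})=B(k,h)$ for all $x\in G$, $k\in K$, $h\in H$. *)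

(* Defs.v *)
From HB Require Import structures.
From mathcomp Require Import all_boot all_order all_algebra all_fingroup.
From mathcomp Require Import mxtens.

Set Implicit Arguments.
Unset Strict Implicit.
Unset Printing Implicit Defensive.

Import GRing.Theory GroupScope.
Local Open Scope ring_scope.

(* D(G) has k-basis e_g # x for g, x in G; an element is stored by its         *)
(* coordinates, so that h (g, x) is the coefficient of e_g # x in h. Here G is *)
(* the whole group gT. The Hopf algebra structure is                           *)
(*   (e_g # x) (e_h # y) = [g = x h x^-1] e_g # x y      1 = \sum_g e_g # 1    *)
(*   Delta (e_g # x) = \sum_(a b = g) (e_a # x) (x) (e_b # x)                  *)
(*   eps (e_g # x) = [g = 1]            S (e_g # x) = e_(x^-1 g^-1 x) # x^-1   *)
(* see ddbM, ddcomulb, ddcounitb and ddantib below. In MathComp,               *)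
(* g ^ x is x^-1 g x.                                                          *)
Definition ddouble (k : fieldType) (gT : finGroupType) : Type :=
  {ffun gT * gT -> k^o}.

Section DrinfeldDouble.
Variables (k : fieldType) (gT : finGroupType).
Implicit Types (g x : gT).

Local Notation D := (ddouble k gT).
Implicit Types (a b c h : D).

HB.instance Definition _ := GRing.Lmodule.copy D {ffun gT * gT -> k^o}.

Definition dd_one : D := [ffun p => (p.2 == 1%g)%:R].
Definition dd_mul a b : D :=
  [ffun p => \sum_x a (p.1, x) * b ((p.1 ^ x)%g, (x^-1 * p.2)%g)].

Fact dd_mulA : associative dd_mul.
Proof.
move=> a b c; apply/ffunP=> -[g z]; rewrite !ffunE /=.
under eq_bigr => x _ do rewrite ffunE /= big_distrr /=.
rewrite exchange_big /=.
rewrite [RHS](eq_bigr (fun y => \sum_x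
  a (g, x) * b ((g ^ x)%g, (x^-1 * y)%g) * c ((g ^ y)%g, (y^-1 * z)%g))); last first.
  by move=> y _; rewrite ffunE /= big_distrl.
rewrite exchange_big [RHS]exchange_big /=; apply: eq_bigr => x _.
rewrite [RHS](reindex_inj (mulgI x)) /=; apply: eq_bigr => w _.
by rewrite mulKg conjgM invMg !mulgA mulrA.
Qed.

Fact dd_mul1 : left_id dd_one dd_mul.
Proof.
move=> a; apply/ffunP=> -[g z]; rewrite ffunE /= (bigD1 1%g) //= big1 => [|x xN1].
  by rewrite ffunE /= eqxx mul1r addr0 conjg1 invg1 mul1g.
by rewrite ffunE /= (negPf xN1) mul0r.
Qed.

Fact dd_mulr1 : right_id dd_one dd_mul.
Proof.
move=> a; apply/ffunP=> -[g z]; rewrite ffunE /= (bigD1 z) //= big1 => [|x xNz].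
  by rewrite ffunE /= mulVg eqxx mulr1 addr0.
by rewrite ffunE /= -eq_mulVg1 (negPf xNz) mulr0.
Qed.

Fact dd_mulDl : left_distributive dd_mul +%R.
Proof.
move=> a b c; apply/ffunP=> p; rewrite !ffunE -big_split /=.
by apply: eq_bigr => x _; rewrite ffunE mulrDl.
Qed.

Fact dd_mulDr : right_distributive dd_mul +%R.
Proof.
move=> a b c; apply/ffunP=> p; rewrite !ffunE -big_split /=.
by apply: eq_bigr => x _; rewrite ffunE mulrDr.
Qed.

Fact dd_oneN0 : dd_one != 0.
Proof.
apply/eqP=> /ffunP/(_ (1%g, 1%g)); rewrite !ffunE eqxx.
by apply/eqP; rewrite oner_eq0.
Qed.

HB.instance Definition _ := GRing.Zmodule_isNzRing.Build D
  dd_mulA dd_mul1 dd_mulr1 dd_mulDl dd_mulDr dd_oneN0.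

Fact dd_scaleAl (l : k) a b : l *: (a * b) = (l *: a) * b.
Proof.
apply/ffunP=> p; rewrite !ffunE scaler_sumr.
by apply: eq_bigr => x _; rewrite ffunE scalerAl.
Qed.

HB.instance Definition _ := GRing.Lmodule_isLalgebra.Build k D dd_scaleAl.

Fact dd_scaleAr (l : k) a b : l *: (a * b) = a * (l *: b).
Proof.
apply/ffunP=> p; rewrite !ffunE scaler_sumr.
by apply: eq_bigr => x _; rewrite ffunE scalerAr.
Qed.

HB.instance Definition _ := GRing.Lalgebra_isAlgebra.Build k D dd_scaleAr.

Definition ddb (p : gT * gT) : D := [ffun q => (q == p)%:R].

(* D(G) (x) D(G), by coordinates on the basis (ddb p) (x) (ddb q). *)
Definition ddouble2 : Type := {ffun (gT * gT) * (gT * gT) -> k^o}.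

Definition ddcomul h : ddouble2 :=
  [ffun pq => if pq.1.2 == pq.2.2 then h ((pq.1.1 * pq.2.1)%g, pq.1.2) else 0].
Definition ddcounit h : k := \sum_x h (1%g, x).
Definition ddanti h : D := [ffun p => h ((p.1^-1 ^ p.2)%g, p.2^-1%g)].

Lemma ddb_sum h : h = \sum_p h p *: ddb p.
Proof.
apply/ffunP=> q; rewrite sum_ffunE (bigD1 q) //= big1 => [|p pNq].
  by rewrite !ffunE eqxx addr0 /GRing.scale /= mulr1.
by rewrite !ffunE eq_sym (negPf pNq) scaler0.
Qed.

Lemma dd1_sum : 1 = \sum_g ddb (g, 1%g).
Proof.
apply/ffunP=> -[g x]; rewrite sum_ffunE !ffunE /= (bigD1 g) //= big1 => [|i iNg].
  by rewrite ffunE xpair_eqE eqxx /= addr0.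
by rewrite ffunE xpair_eqE eq_sym (negPf iNg).
Qed.

Lemma ddbM g1 x1 g2 x2 : ddb (g1, x1) * ddb (g2, x2) =
  (g1 == x1 * g2 * x1^-1)%g%:R *: ddb (g1, (x1 * x2)%g).
Proof.
apply/ffunP=> -[g x]; rewrite !ffunE /= (bigD1 x1) //= big1 => [|y yNx].
  rewrite !ffunE !xpair_eqE eqxx andbT addr0 /GRing.scale /=.
  have [->|_] := eqVneq g g1; last by rewrite mul0r mulr0.
  rewrite mul1r -natrM mulnb !(can2_eq (mulKVg x1) (mulKg x1)).
  by rewrite (can2_eq (mulgK x1) (mulgKV x1)).
by rewrite !ffunE !xpair_eqE (negPf yNx) andbF mul0r.
Qed.

Lemma ddcomulb g x p q : ddcomul (ddb (g, x)) (p, q) =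
  [&& p.1 * q.1 == g, p.2 == x & q.2 == x]%g%:R.
Proof.
case: p q => [a y] [b z]; rewrite !ffunE /= xpair_eqE.
have [->|yNz] := eqVneq y z; first by rewrite andbb.
have [<-|_] := eqVneq y x; last by rewrite !andbF.
by rewrite eq_sym in yNz; rewrite (negPf yNz) !andbF.
Qed.

Lemma ddcounitb g x : ddcounit (ddb (g, x)) = (g == 1%g)%:R.
Proof.
rewrite /ddcounit (bigD1 x) //= big1 => [|y yNx].
  by rewrite ffunE xpair_eqE eqxx andbT addr0 eq_sym.
by rewrite ffunE xpair_eqE (negPf yNx) andbF.
Qed.

Lemma ddantib g x :
  ddanti (ddb (g, x)) = ddb ((x^-1 * g^-1 * x)%g, x^-1%g).
Proof.
apply/ffunP=> -[h y]; rewrite !ffunE !xpair_eqE /= (can2_eq invgK invgK).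
have [->|_] := eqVneq y x^-1%g; last by rewrite !andbF.
rewrite !andbT; congr (_%:R).
rewrite (can2_eq (conjgKV x) (conjgK x)) (can2_eq invgK invgK).
by rewrite -conjVg conjgE mulgA.
Qed.

Lemma dd_is_monoid_morphism n (f : {linear D -> 'M[k]_n}) :
    f 1 = 1 -> (forall p q, f (ddb p * ddb q) = f (ddb p) * f (ddb q)) ->
  monoid_morphism f.
Proof.
move=> f1 fM; split=> // a b; rewrite (ddb_sum a) (ddb_sum b).
rewrite mulr_suml !linear_sum mulr_suml /=; apply: eq_bigr => p _.
rewrite mulr_sumr !linear_sum mulr_sumr /=; apply: eq_bigr => q _.
by rewrite -scalerAl -scalerAr !linearZ /= fM; rewrite -[RHS]/(_ *m _) -scalemxAl -scalemxAr.
Qed.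

End DrinfeldDouble.

Section Modules.
Variables (k : fieldType) (gT : finGroupType).
Local Notation D := (ddouble k gT).
Implicit Types (h : D).

(* A finite-dimensional left D(G)-module, as k^n (column vectors) with the     *)
(* action given by a unital k-algebra morphism D(G) -> 'M[k]_n; n = 0 is       *)
(* allowed.                                                                    *)
Record ddmod := DDmod {
  dddim : nat;
  ddact :> {lrmorphism D -> 'M[k]_dddim} }.

Implicit Types U V W : ddmod.

Definition ddhom V W (X : 'M[k]_(dddim W, dddim V)) : Prop :=
  forall h, X *m V h = W h *m X.

Definition ddiso V W : Prop :=
  exists X : 'M[k]_(dddim W, dddim V), exists Y : 'M[k]_(dddim V, dddim W),
    [/\ ddhom X, ddhom Y, Y *m X = 1%:M & X *m Y = 1%:M].

Definition dd1_act h : 'M[k]_1 := (ddcounit h)%:M.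

Fact dd1_is_linear : linear dd1_act.
Proof.
move=> l a b; rewrite /dd1_act /ddcounit scale_scalar_mx -raddfD /=; congr _%:M.
by rewrite mulr_sumr -big_split; apply: eq_bigr => x _; rewrite !ffunE.
Qed.
HB.instance Definition _ :=
  GRing.isLinear.Build k D 'M[k]_1 *:%R dd1_act dd1_is_linear.

Fact dd1_is_monoid_morphism : monoid_morphism dd1_act.
Proof.
apply: dd_is_monoid_morphism => [|[g1 x1] [g2 x2]].
  rewrite /= /dd1_act /ddcounit (bigD1 1%g) //= big1 => [|x xN1].
    by rewrite ffunE eqxx addr0.
  by rewrite ffunE (negPf xN1).
rewrite ddbM linearZ /= /dd1_act !ddcounitb -[RHS]scalar_mxM.
rewrite scale_scalar_mx -!natrM !mulnb; congr (_%:R%:M).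
have [->|_] := eqVneq g1 1%g; rewrite ?andbF //= ?andbT.
by rewrite eq_sym -eq_mulgV1 -[X in _ == X]mulg1 (inj_eq (mulgI _)).
Qed.
HB.instance Definition _ :=
  GRing.isMonoidMorphism.Build D 'M[k]_1 dd1_act dd1_is_monoid_morphism.

Definition dd1 : ddmod := DDmod dd1_act.

Definition ddadd_act V W h : 'M[k]_(dddim V + dddim W) :=
  block_mx (V h) 0 0 (W h).

Fact ddadd_is_linear V W : linear (ddadd_act V W).
Proof.
move=> l a b; rewrite /ddadd_act scale_block_mx add_block_mx !linearP.
by rewrite !scaler0 !addr0.
Qed.
HB.instance Definition _ V W := GRing.isLinear.Build k D
  'M[k]_(dddim V + dddim W) *:%R (ddadd_act V W) (ddadd_is_linear V W).

Fact ddadd_is_monoid_morphism V W : monoid_morphism (ddadd_act V W).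
Proof.
split=> [|a b]; rewrite /ddadd_act ?rmorph1 -?scalar_mx_block //.
by rewrite !rmorphM [RHS]mulmx_block !mulmx0 !mul0mx !addr0 !add0r.
Qed.
HB.instance Definition _ V W := GRing.isMonoidMorphism.Build D
  'M[k]_(dddim V + dddim W) (ddadd_act V W) (ddadd_is_monoid_morphism V W).

Definition ddadd V W : ddmod := DDmod (ddadd_act V W).

Definition ddtens_act V W h : 'M[k]_(dddim V * dddim W) :=
  \sum_pq ddcomul h pq *: (V (ddb k pq.1) *t W (ddb k pq.2)).

Fact ddtens_is_linear V W : linear (ddtens_act V W).
Proof.
move=> l a b; rewrite /ddtens_act scaler_sumr -big_split.
apply: eq_bigr => pq _ /=.
have -> : ddcomul (l *: a + b) pq = l * ddcomul a pq + ddcomul b pq :> k.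
  by rewrite !ffunE; case: ifP => _; rewrite ?ffunE // mulr0 addr0.
by rewrite scalerDl scalerA.
Qed.
HB.instance Definition _ V W := GRing.isLinear.Build k D
  'M[k]_(dddim V * dddim W) *:%R (ddtens_act V W) (ddtens_is_linear V W).

Fact ddtens_actb V W g x : ddtens_act V W (ddb k (g, x)) =
  \sum_y V (ddb k (y, x)) *t W (ddb k ((y^-1 * g)%g, x)).
Proof.
pose t y : (gT * gT) * (gT * gT) := ((y, x), ((y^-1 * g)%g, x)).
have t_inj : injective t by move=> y z [].
rewrite /ddtens_act (bigID (mem [set t y | y : gT])) /= [X in _ + X]big1.
  rewrite addr0 big_imset => [|? ? _ _ /t_inj //].
  apply: eq_big => // y _.
  by rewrite ddcomulb /= mulKVg !eqxx scale1r.
move=> [[a y] [b z]] ttN; rewrite ddcomulb /=; case: and3P => [[ab yx zx]|_].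
  case/imsetP: ttN; exists a => //.
  by rewrite /t (eqP yx) (eqP zx) -(eqP ab) mulKg.
by rewrite scale0r.
Qed.

Fact ddtens_is_monoid_morphism V W : monoid_morphism (ddtens_act V W).
Proof.
have sumL m n m' n' (F : gT -> 'M[k]_(m, n)) (B : 'M[k]_(m', n')) :
    (\sum_g F g) *t B = \sum_g F g *t B.
  apply/matrixP=> i j; rewrite mxE summxE mulr_suml summxE.
  by apply: eq_bigr => g _; rewrite mxE.
have sumR m n m' n' (F : gT -> 'M[k]_(m, n)) (B : 'M[k]_(m', n')) :
    B *t (\sum_g F g) = \sum_g B *t F g.
  apply/matrixP=> i j; rewrite mxE summxE mulr_sumr summxE.
  by apply: eq_bigr => g _; rewrite mxE.
have scaleLR m n m' n' (a b : k) (A : 'M[k]_(m, n)) (B : 'M[k]_(m', n')) :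
    (a *: A) *t (b *: B) = (a * b) *: (A *t B).
  by apply/matrixP=> i j; rewrite !mxE mulrACA.
apply: dd_is_monoid_morphism => [|[g1 x1] [g2 x2]].
  transitivity ((1%:M : 'M[k]_(dddim V)) *t (1%:M : 'M[k]_(dddim W))).
    have -> : (1%:M : 'M[k]_(dddim V)) = V 1 by exact: esym (rmorph1 V).
    have -> : (1%:M : 'M[k]_(dddim W)) = W 1 by exact: esym (rmorph1 W).
    rewrite !dd1_sum !linear_sum /= sumL.
    under eq_bigr => g _ do rewrite ddtens_actb.
    rewrite exchange_big; apply: eq_bigr => y _ /=.
    rewrite sumR (reindex_inj (mulgI y)) /=.
    by apply: eq_bigr => z _; rewrite mulKg.
  apply/matrixP=> i j; case: (mxtens_indexP i) => i0 i1.
  case: (mxtens_indexP j) => j0 j1; rewrite tensmxE !mxE -natrM mulnb.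
  congr (_%:R); rewrite (inj_eq (can_inj (@mxtens_indexK _ _))).
  by rewrite xpair_eqE.
rewrite ddbM linearZ /= !ddtens_actb mulr_suml scaler_sumr /=.
apply: eq_bigr => y _; rewrite mulr_sumr.
pose c := (y ^ x1)%g.
rewrite (bigD1 c) //= big1 => [|z zNc].
  rewrite addr0 [RHS]tensmx_mul -![_ *m _]rmorphM /= !ddbM !linearZ /=.
  rewrite scaleLR; congr (_ *: _); rewrite -natrM mulnb; congr (_%:R).
  rewrite /c conjgE !mulgA mulgV mul1g -!mulgA mulgV mulg1 eqxx /=.
  rewrite !invMg !invgK !mulgA mulgV mul1g -!mulgA.
  by rewrite (inj_eq (mulgI _)).
rewrite [LHS]tensmx_mul -![_ *m _]rmorphM /= !ddbM linearZ /=.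
case: eqP => [yE|_]; last by rewrite scale0r tens0mx.
by case/eqP: zNc; rewrite /c yE conjgE !mulgA mulVg mul1g mulgKV.
Qed.
HB.instance Definition _ V W := GRing.isMonoidMorphism.Build D
  'M[k]_(dddim V * dddim W) (ddtens_act V W) (ddtens_is_monoid_morphism V W).

Definition ddtens V W : ddmod := DDmod (ddtens_act V W).

Definition dddual_act V h : 'M[k]_(dddim V) := (V (ddanti h))^T.

Fact dddual_is_linear V : linear (dddual_act V).
Proof.
move=> l a b; rewrite /dddual_act -!linearP; congr (V _)^T.
by apply/ffunP=> p; rewrite !ffunE.
Qed.
HB.instance Definition _ V := GRing.isLinear.Build k D
  'M[k]_(dddim V) *:%R (dddual_act V) (dddual_is_linear V).

Fact dddual_is_monoid_morphism V : monoid_morphism (dddual_act V).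
Proof.
apply: dd_is_monoid_morphism => [|[g1 x1] [g2 x2]].
  rewrite /= /dddual_act (_ : ddanti 1 = 1) ?rmorph1 ?trmx1 //.
  by apply/ffunP=> p; rewrite !ffunE /= (can2_eq invgK invgK) invg1.
rewrite ddbM linearZ /= /dddual_act [RHS](esym (trmx_mul _ _)).
rewrite -[_ *m _]rmorphM /= !ddantib ddbM linearZ linearZ /= invMg.
have -> : (x2^-1 * g2^-1 * x2 ==
    x2^-1 * (x1^-1 * g1^-1 * x1) * x2^-1^-1)%g = (g1 == x1 * g2 * x1^-1)%g.
  rewrite invgK (inj_eq (mulIg _)) (inj_eq (mulgI _)).
  rewrite eq_sym (can2_eq (mulgK _) (mulgKV _)) (can2_eq (mulKVg _) (mulKg _)).
  by rewrite (can2_eq invgK invgK) !invMg !invgK.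
case: eqP => [->|_]; rewrite ?scale0r // !scale1r; congr (V (ddb k (_, _)))^T.
by rewrite !invMg !invgK !mulgA mulgKV mulgKV.
Qed.
HB.instance Definition _ V := GRing.isMonoidMorphism.Build D
  'M[k]_(dddim V) (dddual_act V) (dddual_is_monoid_morphism V).

Definition dddual V : ddmod := DDmod (dddual_act V).

Definition ddsummand V W : Prop := exists U, ddiso W (ddadd V U).

(* A full subcategory is determined by its class of objects. The zero module   *)
(* (the empty direct sum) belongs to every such class, being a direct summand  *)
(* of the unit object.                                                         *)
Record fusion_subcategory := FusionSubcategory {
  fsub_obj :> ddmod -> Prop;
  fsub_iso : forall V W, ddiso V W -> fsub_obj V -> fsub_obj W;
  fsub_unit : fsub_obj dd1;
  fsub_sum : forall V W, fsub_obj V -> fsub_obj W -> fsub_obj (ddadd V W);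
  fsub_summand : forall V W, ddsummand V W -> fsub_obj W -> fsub_obj V;
  fsub_tens : forall V W, fsub_obj V -> fsub_obj W -> fsub_obj (ddtens V W);
  fsub_dual : forall V, fsub_obj V -> fsub_obj (dddual V) }.

End Modules.

Section Bicharacters.
Variables (k : fieldType) (gT : finGroupType) (K H : {group gT}).
Local Open Scope group_scope.

Definition bicharacter (B : {ffun [subg K] * [subg H] -> k}) : Prop :=
  [/\ forall x y, (B (x, y) != 0)%R,
      forall x1 x2 y, B (x1 * x2, y) = (B (x1, y) * B (x2, y))%R
    & forall x y1 y2, B (x, y1 * y2) = (B (x, y1) * B (x, y2))%R].

(* For K and H normal, g * x * g^-1 stays in the subgroup, and subg is then    *)
(* the mere injection of its members into the subtype.                         *)
Definition bichar_invariant (B : {ffun [subg K] * [subg H] -> k}) : Prop :=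
  forall (g : gT) (x : [subg K]) (y : [subg H]),
    B (subg K (g * sgval x * g^-1), subg H (g * sgval y * g^-1)) = B (x, y).

End Bicharacters.

Record bichar_triple (k : fieldType) (gT : finGroupType) := BicharTriple {
  bt_K : {group gT};
  bt_H : {group gT};
  bt_B : {ffun [subg bt_K] * [subg bt_H] -> k};
  bt_normalK : (bt_K <| [set: gT])%g;
  bt_normalH : (bt_H <| [set: gT])%g;
  bt_centralize :
    forall x y, x \in bt_K -> y \in bt_H -> (x * y = y * x)%g;
  bt_bichar : bicharacter bt_B;
  bt_invariant : bichar_invariant bt_B }.

(* Main.v *)
(** A [D(G)]-module is a [G]-graded space [V] on which [x] in [G] maps [V_g] to
    [V_(x g x^-1)]. A triple [(K, H, B)] defines the fusion subcategory of those
    [V] that are supported on [K] and on which [h] in [H] acts on [V_g] as the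
    scalar [B(g, h)]; the triple is recovered from it because the central
    idempotent [\sum_(g in K) e_g |H|^-1 \sum_(h in H) B(g, h)^-1 h] of [D(G)]
    generates an object with [V_g <> 0] for all [g] in [K].

    Conversely, given a fusion subcategory [C], let [K] be the set of the [g] with
    [V_g <> 0] for some [V] in [C], and [H] the common kernel of the [G]-modules
    [V_1], [V] in [C]. As [H] acts trivially on [(V (x) V^* )_1], it acts by scalars
    on each [V_g], which defines [B]. It remains to see that [C] contains every
    object [V] of the subcategory of [(K, H, B)]. The matrix coefficients of the
    modules [V_1], [V] in [C], form an algebra of functions on [G] that separates
    the points outside [H] from [1], so it contains the indicator function of [H]
    (as in the Burnside-Brauer theorem). Tensoring with a [W] in [C] such that
    [W_g <> 0], one gets [Z] in [C], [w] in [Z_g] and a functional [p] on [Z_g] with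
    [p (x w) = B(g, x)] for [x] in [H] and [0] for the other [x]. For [v] in [V_g]
    and [l] in [V_g^*], the averages over [G] of the rank one maps [w l] and [v p]
    are morphisms whose composite is a multiple of the average of [v l]; these
    averages span the identity of [V], which is thus a direct summand of a sum of
    such [Z]. *)

Require Import Defs.
From HB Require Import structures.
From mathcomp Require Import all_boot all_order all_algebra all_fingroup.
From mathcomp Require Import mxtens boolp.

Set Implicit Arguments.
Unset Strict Implicit.
Unset Printing Implicit Defensive.

Import GRing.Theory GroupScope.
Local Open Scope ring_scope.

(** * Modules over [D(G)]: split idempotents, retracts, averages *)

Section Modules.
Variables (k : fieldType) (gT : finGroupType).
Local Notation D := (ddouble k gT).
Local Notation ddmod := (ddmod k gT).
Local Notation e g := (ddb k (g, 1%g)).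
Implicit Types (U V W : ddmod) (a b : D) (g h x y z : gT).

(* The group element [x], as an element of [D(G)]. *)
Definition ddu x : D := \sum_g ddb k (g, x).

Lemma ddbMJ g1 x1 g2 x2 : ddb k (g1, x1) * ddb k (g2, x2) =
  (g1 ^ x1 == g2)%g%:R *: ddb k (g1, (x1 * x2)%g).
Proof. by rewrite ddbM (can2_eq (conjgK x1) (conjgKV x1)) conjgE invgK mulgA. Qed.

Lemma ddbM_conj g x y : ddb k (g, x) * ddb k ((g ^ x)%g, y) = ddb k (g, (x * y)%g).
Proof. by rewrite ddbMJ eqxx scale1r. Qed.

Lemma ddbMu g x y : ddb k (g, x) * ddu y = ddb k (g, (x * y)%g).
Proof.
rewrite mulr_sumr (bigD1 (g ^ x)%g) //= ddbM_conj big1 ?addr0 // => h hN.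
by rewrite ddbMJ eq_sym (negPf hN) scale0r.
Qed.

Lemma dduMb x g y : ddu x * ddb k (g, y) = ddb k ((g ^ x^-1)%g, (x * y)%g).
Proof.
rewrite mulr_suml (bigD1 (g ^ x^-1)%g) //= -{2}[g](conjgKV x) ddbM_conj.
rewrite big1 ?addr0 // => h hN; rewrite ddbMJ.
by rewrite (can2_eq (conjgK x) (conjgKV x)) (negPf hN) scale0r.
Qed.

Lemma dduM x y : ddu x * ddu y = ddu (x * y)%g.
Proof. by rewrite mulr_suml; apply: eq_bigr => g _; rewrite ddbMu. Qed.

Lemma ddu1 : ddu 1%g = 1. Proof. by rewrite dd1_sum. Qed.

Lemma ddactM V a b : V (a * b) = V a *m V b. Proof. exact: rmorphM. Qed.
Lemma ddact1 V : V 1 = 1%:M. Proof. exact: rmorph1. Qed.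

Lemma ddact_uK V x : V (ddu x) *m V (ddu x^-1%g) = 1%:M.
Proof. by rewrite -ddactM dduM mulgV ddu1 ddact1. Qed.

Lemma ddact_e V g h : V (e g) *m V (e h) = (g == h)%:R *: V (e g).
Proof. by rewrite -ddactM ddbMJ conjg1 mulg1 linearZ. Qed.

Lemma ddact_sum_e V : \sum_g V (e g) = 1%:M.
Proof. rewrite -linear_sum -dd1_sum; exact: ddact1. Qed.

(** Bundled by hand, so that a module can be built inside a proof. *)
Definition ddmod_of n (f : D -> 'M[k]_n) (fL : linear f)
    (fM : monoid_morphism f) : ddmod :=
  DDmod (HB.pack_for {lrmorphism D -> 'M[k]_n} f
    (GRing.isLinear.Build k D 'M[k]_n *:%R f fL)
    (GRing.isMonoidMorphism.Build D 'M[k]_n f fM)).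

Lemma ddhom_basis V W (X : 'M[k]_(dddim W, dddim V)) :
  (forall p, X *m V (ddb k p) = W (ddb k p) *m X) -> ddhom X.
Proof.
move=> XP h; rewrite (ddb_sum h) !linear_sum mulmx_suml; apply: eq_bigr => p _.
by rewrite !linearZ -!scalemxAl /= XP.
Qed.

(** The image of [E] in coordinates: a full rank factorization [E = C *m R] satisfies [R *m C = 1],
    and [h] acts by [R *m U h *m C]. *)
Lemma split_idempotent U (E : 'M[k]_(dddim U)) : ddhom E -> E *m E = E ->
  exists V, exists (I : 'M_(dddim U, dddim V)) (P : 'M_(dddim V, dddim U)),
    [/\ ddhom I, ddhom P, P *m I = 1%:M & I *m P = E].
Proof.
move=> EU EE.
have [r [C [R [CR C_full R_free]]]] :
  exists r (C : 'M_(dddim U, r)) (R : 'M_(r, dddim U)),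
    [/\ C *m R = E, row_full C & row_free R].
  exists (\rank E), (col_base E), (row_base E).
  by rewrite mulmx_base col_base_full row_base_free.
have RC : R *m C = 1%:M.
  apply: (row_full_inj C_full); apply: (row_free_inj R_free).
  by rewrite /= mulmx1 !mulmxA CR -mulmxA CR EE.
pose f (h : D) := R *m U h *m C.
have fL : linear f.
  by move=> l a b; rewrite /f linearP mulmxDr mulmxDl -scalemxAr -scalemxAl.
have RE : R *m E = R by rewrite -CR mulmxA RC mul1mx.
have EC : E *m C = C by rewrite -CR -mulmxA RC mulmx1.
have fM : monoid_morphism f.
  split; first by rewrite /f ddact1 mulmx1.
  move=> a b; rewrite -[RHS]/(_ *m _) /f ddactM -!mulmxA [C *m _]mulmxA CR.
  by rewrite [E *m _]mulmxA EU -mulmxA EC.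
exists (ddmod_of fL fM), C, R; split => // h.
  by rewrite /= /f !mulmxA CR EU -mulmxA EC.
by rewrite /= /f -!mulmxA CR -EU mulmxA RE.
Qed.

Lemma ddhom0 V W : ddhom (0 : 'M_(dddim W, dddim V)).
Proof. by move=> h; rewrite mul0mx mulmx0. Qed.

Lemma ddhomZ V W l (X : 'M_(dddim W, dddim V)) : ddhom X -> ddhom (l *: X).
Proof. by move=> XP h; rewrite -scalemxAl -scalemxAr XP. Qed.

(** A complement is the image of the idempotent [1 - I *m P]. *)
Lemma retract_summand V U (I : 'M_(dddim U, dddim V)) (P : 'M_(dddim V, dddim U)) :
  ddhom I -> ddhom P -> P *m I = 1%:M -> ddsummand V U.
Proof.
move=> IU PU PI.
have IPhom : ddhom (1%:M - I *m P : 'M_(dddim U)).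
  move=> h; rewrite mulmxBl mulmxBr mul1mx mulmx1; congr (_ - _).
  by rewrite -mulmxA PU !mulmxA IU.
case: (split_idempotent IPhom).
  rewrite mulmxBl !mulmxBr mul1mx mulmx1 mul1mx -mulmxA [P *m _]mulmxA PI.
  by rewrite mul1mx subrr subr0.
move=> W [J [Q [JU QU QJ JQ]]]; exists W.
have QI : Q *m I = 0.
  rewrite -[Q]mul1mx -QJ -2!mulmxA [J *m _]mulmxA JQ mulmxBl mul1mx.
  by rewrite -mulmxA PI mulmx1 subrr mulmx0.
have PJ : P *m J = 0.
  rewrite -[J]mulmx1 -QJ 2!mulmxA -(mulmxA P) JQ mulmxBr mulmx1.
  by rewrite mulmxA PI mul1mx subrr mul0mx.
exists (col_mx P Q), (row_mx I J); split.
- by move=> h; rewrite /= /ddadd_act mul_col_mx mul_block_col !mul0mx addr0 add0r PU QU.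
- by move=> h; rewrite /= /ddadd_act mul_row_block mul_mx_row !mulmx0 addr0 add0r IU JU.
- by rewrite mul_row_col JQ addrC subrK.
- by rewrite mul_col_row PI QJ PJ QI -scalar_mx_block.
Qed.

Section Factor.
Variable C : fusion_subcategory k gT.

(** For fixed [V] these maps form a subspace, thanks to direct sums; if it contains the identity,
    [V] is a retract of an object of [C]. *)
Definition factors V (X : 'M[k]_(dddim V)) : Prop :=
  exists2 U, C U & exists (I : 'M_(dddim U, dddim V)) (P : 'M_(dddim V, dddim U)),
    [/\ ddhom I, ddhom P & P *m I = X].

Lemma factors0 V : factors (0 : 'M_(dddim V)).
Proof.
exists (dd1 k gT); first exact: fsub_unit.
by exists 0, 0; rewrite mul0mx; split=> //; apply: ddhom0.
Qed.

Lemma factorsD V (X Y : 'M_(dddim V)) : factors X -> factors Y -> factors (X + Y).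
Proof.
move=> [U CU [I [P [IU PU <-]]]] [W CW [J [Q [JU QU <-]]]].
exists (ddadd U W); first exact: fsub_sum.
exists (col_mx I J), (row_mx P Q); split; last by rewrite mul_row_col.
- by move=> h; rewrite /= /ddadd_act mul_col_mx mul_block_col !mul0mx addr0 add0r IU JU.
- by move=> h; rewrite /= /ddadd_act mul_row_block mul_mx_row !mulmx0 addr0 add0r PU QU.
Qed.

Lemma factorsZ V l (X : 'M_(dddim V)) : factors X -> factors (l *: X).
Proof.
move=> [U CU [I [P [IU PU <-]]]]; exists U => //; exists I, (l *: P).
by split=> //; [apply: ddhomZ | rewrite -scalemxAl].
Qed.

Lemma factors_sum V (J : finType) (X : J -> 'M_(dddim V)) :
  (forall j, factors (X j)) -> factors (\sum_j X j).
Proof. by move=> XP; elim/big_ind: _ => //; [apply: factors0 | apply: factorsD]. Qed.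

Lemma factors_id V : factors (1%:M : 'M_(dddim V)) -> C V.
Proof.
move=> [U CU [I [P [IU PU PI]]]].
exact: fsub_summand (retract_summand IU PU PI) CU.
Qed.

End Factor.

Definition ddavg V W (X : 'M[k]_(dddim W, dddim V)) : 'M_(dddim W, dddim V) :=
  \sum_x W (ddu x) *m X *m V (ddu x^-1%g).

(** Multiplying by a group element only permutes the summands; as [X] preserves the grading, the
    [e g] pass through as well. *)
Lemma ddavg_hom V W (X : 'M[k]_(dddim W, dddim V)) :
  (forall g, X *m V (e g) = W (e g) *m X) -> ddhom (ddavg X).
Proof.
move=> Xe; apply: ddhom_basis => -[a y].
rewrite mulmx_suml mulmx_sumr [RHS](reindex_inj (mulgI y^-1%g)) /=.
apply: eq_bigr => x _.
have -> : W (ddu x) *m X *m V (ddu x^-1%g) *m V (ddb k (a, y)) =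
    W (ddu x) *m (X *m V (e (a ^ x)%g)) *m V (ddu (x^-1 * y)%g).
  rewrite -!mulmxA -!ddactM ddbMu dduMb invgK.
  by rewrite mul1g.
rewrite Xe !mulmxA -!ddactM dduMb ddbMu mulKVg -conjgM mulgV conjg1 mulg1.
by rewrite invMg invgK.
Qed.

End Modules.

(** * Kronecker products *)

Section TensorLinearity.
Variable k : fieldType.

Lemma tensmxZ m n p q (l l' : k) (A : 'M[k]_(m, n)) (B : 'M[k]_(p, q)) :
  (l *: A) *t (l' *: B) = (l * l') *: (A *t B).
Proof. by apply/matrixP=> i j; rewrite !mxE mulrACA. Qed.

Lemma tensmx_neq0 m n p q (A : 'M[k]_(m, n)) (B : 'M[k]_(p, q)) :
  A != 0 -> B != 0 -> A *t B != 0.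
Proof.
move=> /matrix0Pn[i [j Aij]] /matrix0Pn[i' [j' Bij]]; apply/matrix0Pn.
by exists (mxtens_index (i, i')), (mxtens_index (j, j')); rewrite tensmxE mulf_neq0.
Qed.

End TensorLinearity.

(** * The fusion subcategory of a triple *)

Section Triples.
Variables (k : fieldType) (gT : finGroupType).
Local Notation D := (ddouble k gT).
Local Notation ddmod := (ddmod k gT).
Local Notation e g := (ddb k (g, 1%g)).
Implicit Types (U V W : ddmod) (g h x y z : gT).

(* Outside [K] and [H], [subg] takes the junk value [1]. *)
Definition bt_val (t : bichar_triple k gT) g h : k :=
  bt_B t (subg (bt_K t) g, subg (bt_H t) h).

Section OneTriple.
Variable t : bichar_triple k gT.
Local Notation K := (bt_K t).
Local Notation H := (bt_H t).
Local Notation B := (bt_val t).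

Lemma bt_val_neq0 g h : B g h != 0.
Proof. by have [B0 _ _] := bt_bichar t; apply: B0. Qed.

Lemma bt_valMl g g' h : g \in K -> g' \in K -> B (g * g')%g h = B g h * B g' h.
Proof.
by move=> Kg Kg'; have [_ Bl Br] := bt_bichar t; rewrite /bt_val morphM // ?Bl ?Br.
Qed.

Lemma bt_valMr g h h' : h \in H -> h' \in H -> B g (h * h')%g = B g h * B g h'.
Proof.
by move=> Hh Hh'; have [_ Bl Br] := bt_bichar t; rewrite /bt_val morphM // ?Bl ?Br.
Qed.

Lemma bt_val1l h : B 1%g h = 1.
Proof.
apply: (mulfI (bt_val_neq0 1%g h)).
by rewrite -bt_valMl ?group1 // mulg1 mulr1.
Qed.

Lemma bt_val1r g : B g 1%g = 1.
Proof.
apply: (mulfI (bt_val_neq0 g 1%g)).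
by rewrite -bt_valMr ?group1 // mulg1 mulr1.
Qed.

Lemma bt_valVV g h : g \in K -> h \in H -> B g^-1%g h^-1%g = B g h.
Proof.
move=> Kg Hh; apply: (mulfI (bt_val_neq0 g h^-1%g)).
rewrite -bt_valMl ?groupV // mulgV bt_val1l -bt_valMr ?groupV //.
by rewrite mulVg bt_val1r.
Qed.

Lemma bt_valVr g h : h \in H -> B g h^-1%g * B g h = 1.
Proof. by move=> Hh; rewrite -bt_valMr ?groupV // mulVg bt_val1r. Qed.

Lemma bt_KJ g x : (g ^ x \in K)%g = (g \in K).
Proof. by rewrite memJ_norm // (subsetP (normal_norm (bt_normalK t))) ?inE. Qed.

Lemma bt_HJ h x : (h ^ x \in H)%g = (h \in H).
Proof. by rewrite memJ_norm // (subsetP (normal_norm (bt_normalH t))) ?inE. Qed.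

Lemma bt_valJ g h x : g \in K -> h \in H -> B (g ^ x)%g (h ^ x)%g = B g h.
Proof.
move=> Kg Hh; rewrite /bt_val -[RHS](@bt_invariant _ _ t x^-1%g) !subgK //.
by rewrite !conjgE invgK !mulgA.
Qed.

Lemma bt_fixJ g h : g \in K -> h \in H -> (g ^ h)%g = g.
Proof. by move=> Kg Hh; rewrite conjgE (bt_centralize Kg Hh) mulKg. Qed.

(** [ddb (g, h)] acts as [h] followed by the projection [e g] to degree [g]; as [h] commutes with
    [g], it preserves that degree. *)
Definition bt_obj V : Prop :=
  (forall g, g \notin K -> V (e g) = 0) /\
  (forall g h, g \in K -> h \in H -> V (ddb k (g, h)) = B g h *: V (e g)).

(** Membership says that certain elements of [D(G)] act as zero, so it passes to any module with a
    larger annihilator. *)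
Lemma bt_obj_mono V W :
  (forall z : D, W z = 0 -> V z = 0) -> bt_obj W -> bt_obj V.
Proof.
move=> VW [W0 WB]; split=> [g Kg | g h Kg Hh]; first by rewrite VW ?W0.
have /VW : W (ddb k (g, h) - B g h *: e g) = 0.
  by rewrite linearB linearZ /= WB ?subrr.
by rewrite linearB linearZ /= => /subr0_eq.
Qed.

Lemma ddiso_mono V W (z : D) : ddiso V W -> V z = 0 -> W z = 0.
Proof.
move=> [X [Y [_ YP _ XY]]] Vz.
by rewrite -[W z]mul1mx -XY -mulmxA YP Vz mul0mx mulmx0.
Qed.

Lemma bt_obj_iso V W : ddiso V W -> bt_obj V -> bt_obj W.
Proof. by move=> VW; apply: bt_obj_mono => z; apply: ddiso_mono. Qed.

Lemma bt_obj_unit : bt_obj (dd1 k gT).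
Proof.
split=> [g Kg | g h Kg Hh]; rewrite /= /dd1_act !ddcounitb.
  by have [g1|_] := eqVneq; [rewrite g1 group1 in Kg | rewrite raddf0].
have [->|_] := eqVneq; first by rewrite bt_val1l scale1r.
by rewrite raddf0 scaler0.
Qed.

Lemma bt_obj_sum V W : bt_obj V -> bt_obj W -> bt_obj (ddadd V W).
Proof.
move=> [V0 VB] [W0 WB]; split=> [g Kg | g h Kg Hh]; rewrite /= /ddadd_act.
  by rewrite V0 // W0 // block_mx0.
by rewrite VB // WB // scale_block_mx !scaler0.
Qed.

Lemma bt_obj_summand V W : ddsummand V W -> bt_obj W -> bt_obj V.
Proof.
move=> [U WVU]; apply: bt_obj_mono => z Wz.
have := ddiso_mono WVU Wz; rewrite /= /ddadd_act -block_mx0.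
by case/eq_block_mx.
Qed.

Lemma bt_obj_tens V W : bt_obj V -> bt_obj W -> bt_obj (ddtens V W).
Proof.
move=> [V0 VB] [W0 WB]; split=> [g Kg | g h Kg Hh]; rewrite /= !ddtens_actb.
  apply: big1 => y _; have [Ky|Ky] := boolP (y \in K); last by rewrite V0 // tens0mx.
  by rewrite W0 ?tensmx0 // groupMl ?groupV.
rewrite scaler_sumr; apply: eq_bigr => y _.
have [Ky|Ky] := boolP (y \in K); last first.
  by rewrite -[h]mul1g -ddbMu ddactM V0 // mul0mx !tens0mx scaler0.
have Kyg : (y^-1 * g)%g \in K by rewrite groupM ?groupV.
by rewrite VB // WB // tensmxZ -bt_valMl // mulKVg.
Qed.

(** Degree [g] of the dual is dual to degree [g^-1] of [V], and [h] acts by the transpose of [h^-1];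
    the two inverses cancel in [B]. *)
Lemma bt_obj_dual V : bt_obj V -> bt_obj (dddual V).
Proof.
move=> [V0 VB]; split=> [g Kg | g h Kg Hh]; rewrite /= /dddual_act !ddantib.
  by rewrite invg1 mul1g mulg1 V0 ?trmx0 ?groupV.
have -> : (h^-1 * g^-1 * h)%g = g^-1%g by rewrite -mulgA -conjgE bt_fixJ ?groupV.
by rewrite VB ?groupV // bt_valVV // linearZ /= invg1 mul1g mulg1.
Qed.

Definition bt_fsub : fusion_subcategory k gT :=
  FusionSubcategory bt_obj_iso bt_obj_unit bt_obj_sum bt_obj_summand
    bt_obj_tens bt_obj_dual.

End OneTriple.
End Triples.

(** * The regular module and the central idempotent of a triple *)

Section Witness.
Variables (k : fieldType) (gT : finGroupType).
Local Notation D := (ddouble k gT).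
Local Notation ddmod := (ddmod k gT).
Local Notation e g := (ddb k (g, 1%g)).
Implicit Types (V : ddmod) (a b : D) (g h x y z : gT).

Definition ddreg_act a : 'M[k]_#|{: gT * gT}| :=
  \matrix_(i, j) (a * ddb k (enum_val j)) (enum_val i).

Fact ddreg_is_linear : linear ddreg_act.
Proof.
move=> l a b; apply/matrixP=> i j.
by rewrite !mxE mulrDl -scalerAl !ffunE.
Qed.

Fact ddreg_is_monoid_morphism : monoid_morphism ddreg_act.
Proof.
split=> [|a b]; apply/matrixP=> i j; rewrite !mxE.
  by rewrite mul1r ffunE (inj_eq enum_val_inj).
rewrite -mulrA [b * _]ddb_sum mulr_sumr sum_ffunE (reindex_onto enum_val enum_rank) /=.
  under eq_bigl => l do rewrite enum_valK eqxx.
by apply: eq_bigr => l _; rewrite -scalerAr ffunE !mxE mulrC.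
by move=> p _; rewrite enum_rankK.
Qed.

Definition ddreg : ddmod := ddmod_of ddreg_is_linear ddreg_is_monoid_morphism.

Lemma ddreg_faithful a : ddreg a = 0 -> a = 0.
Proof.
move=> a0; have ab0 p : a * ddb k p = 0.
  apply/ffunP=> q; rewrite [RHS]ffunE.
  have /matrixP/(_ (enum_rank q) (enum_rank p)) := a0.
  by rewrite !mxE !enum_rankK.
by rewrite -[a]mulr1 dd1_sum mulr_sumr big1.
Qed.

(** [V] is the ideal generated by [c], cut out of the regular module by the action of [c]. *)
Lemma central_idempotent_ddmod (c : D) : (forall a, c * a = a * c) -> c * c = c ->
  exists V, forall a, V a = 0 <-> a * c = 0.
Proof.
move=> cC cc; have cU : @ddhom k gT ddreg ddreg (ddreg c).
  by move=> a; rewrite -!ddactM cC.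
have [|V [I [P [IU PU PI IP]]]] := split_idempotent cU; first by rewrite -ddactM cc.
exists V => a; split=> [Va | ac].
  by apply: ddreg_faithful; rewrite ddactM -IP mulmxA -IU Va mulmx0 mul0mx.
have aI : ddreg a *m I = 0.
  by rewrite -[I]mulmx1 -PI (mulmxA I) IP mulmxA -ddactM ac linear0 mul0mx.
by rewrite -[V a]mulmx1 -PI mulmxA -PU -mulmxA aI mulmx0.
Qed.

Variable t : bichar_triple k gT.
Local Notation K := (bt_K t).
Local Notation H := (bt_H t).
Local Notation B := (bt_val t).

Definition bt_idem : D := #|H|%:R^-1 *:
  \sum_(g in K) \sum_(h in H) B g h^-1%g *: ddb k (g, h).

Lemma ddb_bt_idem g x : ddb k (g, x) * bt_idem =
  if g \in K then #|H|%:R^-1 *: \sum_(h in H) B g h^-1%g *: ddb k (g, (h * x)%g)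
  else 0.
Proof.
rewrite -scalerAr mulr_sumr -(bt_KJ t g x).
case: ifPn => [Kgx|Kgx]; last first.
  rewrite big1 ?scaler0 // => a Ka; rewrite mulr_sumr big1 // => h _.
  rewrite -scalerAr ddbMJ; case: eqP => [gxa|_]; last by rewrite scale0r scaler0.
  by rewrite gxa Ka in Kgx.
congr (_ *: _); rewrite (bigD1 (g ^ x)%g) //= [X in _ + X]big1 => [|a /andP[_ aN]].
  (* With [h] replaced by [h ^ x], again in [H], the product [x (h ^ x)] becomes [h x], and [B] is
     unchanged by invariance. *)
  rewrite addr0 mulr_sumr (reindex_inj (conjg_inj x)) /=.
  apply: eq_big => h; rewrite bt_HJ // => Hh.
  rewrite -scalerAr ddbM_conj -conjVg bt_valJ ?groupV //; last by rewrite -(bt_KJ t g x).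
  by rewrite conjgE mulKVg.
rewrite mulr_sumr big1 // => h _.
by rewrite -scalerAr ddbMJ eq_sym (negPf aN) scale0r scaler0.
Qed.

Lemma bt_idem_ddb g x : bt_idem * ddb k (g, x) = ddb k (g, x) * bt_idem.
Proof.
rewrite ddb_bt_idem -scalerAl mulr_suml; case: ifPn => [Kg|Kg].
  congr (_ *: _); rewrite (bigD1 g) //= [X in _ + X]big1 => [|a /andP[Ka aN]].
    rewrite addr0 mulr_suml; apply: eq_bigr => h Hh.
    by rewrite -scalerAl ddbMJ (bt_fixJ Kg Hh) eqxx scale1r.
  rewrite mulr_suml big1 // => h Hh.
  by rewrite -scalerAl ddbMJ (bt_fixJ Ka Hh) (negPf aN) scale0r scaler0.
rewrite big1 ?scaler0 // => a Ka; rewrite mulr_suml big1 // => h Hh.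
rewrite -scalerAl ddbMJ (bt_fixJ Ka Hh); case: eqP => [ag|_].
  by rewrite -ag Ka in Kg.
by rewrite scale0r scaler0.
Qed.

Lemma bt_idem_central a : bt_idem * a = a * bt_idem.
Proof.
rewrite (ddb_sum a) mulr_sumr mulr_suml; apply: eq_bigr => -[g x] _.
by rewrite -scalerAr bt_idem_ddb scalerAl.
Qed.

Lemma ddb_bt_idem_val g h : g \in K -> h \in H ->
  ddb k (g, h) * bt_idem = B g h *: (e g * bt_idem).
Proof.
move=> Kg Hh; rewrite !ddb_bt_idem Kg scalerA mulrC -scalerA scaler_sumr.
congr (_ *: _); rewrite (reindex_inj (mulIg h^-1%g)) /=.
apply: eq_big => x; rewrite groupMr ?groupV // => Hx.
rewrite mulgKV mulg1 scalerA invMg invgK; congr (_ *: _).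
by rewrite bt_valMr ?groupV.
Qed.

Hypothesis char0 : [pchar k] =i pred0.

Lemma natG_neq0 (G : {group gT}) : #|G|%:R != 0 :> k.
Proof. by move/pcharf0P: char0 => ->; rewrite -lt0n cardG_gt0. Qed.

(** [ddb (g, h) * bt_idem] is [B g h *: (e g * bt_idem)], and [B g h] cancels the coefficient
    [B g h^-1]; the sum over [H] then cancels [1 / |H|]. *)
Lemma bt_idem_idem : bt_idem * bt_idem = bt_idem.
Proof.
rewrite {1}/bt_idem -scalerAl mulr_suml.
transitivity (\sum_(g in K) e g * bt_idem).
  rewrite scaler_sumr; apply: eq_bigr => g Kg; rewrite mulr_suml.
  rewrite (eq_bigr (fun=> e g * bt_idem)) => [|h Hh].
    by rewrite sumr_const -scaler_nat scalerA mulVf ?natG_neq0 // scale1r.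
  by rewrite -scalerAl ddb_bt_idem_val // scalerA bt_valVr // scale1r.
rewrite -[RHS]mul1r dd1_sum mulr_suml [RHS](bigID [in K]) /=.
rewrite [X in _ = _ + X]big1 ?addr0 //.
by move=> g /negPf Kg; rewrite ddb_bt_idem Kg.
Qed.

Lemma ddb_bt_idem_coord g x z : g \in K ->
  (ddb k (g, x) * bt_idem) (g, z) =
  if (z * x^-1)%g \in H then #|H|%:R^-1 * B g (x * z^-1)%g else 0.
Proof.
move=> Kg; rewrite ddb_bt_idem Kg ffunE sum_ffunE /GRing.scale /=.
have zE h : ((g, z) == (g, h * x)%g) = (h == z * x^-1)%g.
  by rewrite xpair_eqE eqxx eq_sym (can2_eq (mulgK x) (mulgKV x)).
case: ifPn => [Hzx|Hzx].
  rewrite (bigD1 (z * x^-1)%g) //= !ffunE zE eqxx big1 ?addr0 => [|h /andP[_ hN]].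
    by rewrite /GRing.scale /= mulr1 invMg invgK.
  by rewrite !ffunE zE (negPf hN) /GRing.scale /= mulr0.
rewrite big1 ?mulr0 // => h Hh; rewrite !ffunE zE /GRing.scale /=.
by case: eqP => [hE|_]; rewrite ?mulr0 // -hE Hh in Hzx *.
Qed.

(** The ideal generated by [bt_idem]. At [(g, 1)] the coordinate of [e g * bt_idem] is [1 / |H|].
    For [h] outside [H], [ddb (1, h) * bt_idem] and [e 1 * bt_idem] differ at [(1, h)]. *)
Lemma bt_obj_witness : exists V, [/\ bt_obj t V,
  forall g, g \in K -> V (e g) != 0
  & forall h, V (ddb k (1%g, h)) = V (e 1%g) -> h \in H].
Proof.
have [V V0] := central_idempotent_ddmod bt_idem_central bt_idem_idem.
have HN0 : #|H|%:R^-1 != 0 :> k by rewrite invr_eq0 natG_neq0.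
exists V; split=> [|g Kg|h Vh].
- split=> [g /negPf Kg | g h Kg Hh]; first by apply/V0; rewrite ddb_bt_idem Kg.
  apply/subr0_eq; rewrite -linearZ -linearB; apply/V0.
  by rewrite mulrBl ddb_bt_idem_val // scalerAl subrr.
- apply/eqP=> /V0/ffunP/(_ (g, 1%g)).
  rewrite ddb_bt_idem_coord // invg1 mulg1 group1 bt_val1r mulr1 ffunE.
  exact/eqP.
- have /V0 : V (ddb k (1%g, h) - e 1%g) = 0 by rewrite linearB /= Vh subrr.
  rewrite mulrBl => /subr0_eq/ffunP/(_ (1%g, h)).
  rewrite !ddb_bt_idem_coord // mulgV group1 bt_val1l mulr1 invg1 mulg1.
  by case: ifP => // _ /eqP; rewrite (negPf HN0).
Qed.

End Witness.

(** * A triple is determined by its subcategory *)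

Lemma bt_fsub_inj (k : fieldType) (gT : finGroupType)
  (char0 : [pchar k] =i pred0) : injective (@bt_fsub k gT).
Proof.
have HP (t : bichar_triple k gT) h : h \in bt_H t <->
    forall V, bt_obj t V -> V (ddb k (1%g, h)) = V (ddb k (1%g, 1%g)).
  split=> [Hh V [_ VB] | Vh]; first by rewrite VB // bt_val1l scale1r.
  have [V [tV _ VH]] := bt_obj_witness t char0; exact/VH/Vh.
have KP (t : bichar_triple k gT) g : g \in bt_K t <->
    exists2 V, bt_obj t V & V (ddb k (g, 1%g)) != 0.
  split=> [Kg | [V [V0 _]]].
    have [V [tV VK _]] := bt_obj_witness t char0; exists V => //; exact: VK.
  by apply: contraR => Kg; rewrite V0.
move=> t t' tt'.
have ott V : bt_obj t V <-> bt_obj t' V.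
  by rewrite -[bt_obj t V]/(bt_fsub t V) tt'.
have eK : bt_K t = bt_K t'.
  apply/group_inj/setP=> g; apply/idP/idP=> /KP[V tV Vg]; apply/KP.
    by exists V => //; apply/ott.
  by exists V => //; apply/ott.
have eH : bt_H t = bt_H t'.
  apply/group_inj/setP=> h; apply/idP/idP=> /HP Vh; apply/HP=> V /ott; exact: Vh.
have eB g h : g \in bt_K t -> h \in bt_H t -> bt_val t g h = bt_val t' g h.
  move=> Kg Hh; have [V [tV VK _]] := bt_obj_witness t char0.
  have [_ t'V] := (ott V).1 tV; have := t'V g h; rewrite -eK -eH.
  have [_ ->] // := tV; move=> /(_ Kg Hh)/eqP.
  by rewrite -subr_eq0 -scalerBl scaler_eq0 (negPf (VK g Kg)) orbF subr_eq0 => /eqP.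
(* The type of [B] depends on [K] and [H], so these are identified first; the last fields are
   proofs. *)
case: t t' eK eH eB {tt' ott} => [K H B nK nH KH bB iB] [K' H' B' nK' nH' KH' bB' iB'] /=.
move=> eK eH; subst K' H' => eB.
have eBB : B = B'.
  apply/ffunP=> -[x y]; have := eB _ _ (subgP x) (subgP y).
  by rewrite /bt_val /= !sgvalK.
move: B' eBB bB' iB' {eB} => _ <- bB' iB'.
by congr BicharTriple; apply: Prop_irrelevance.
Qed.

(** * The triple of a fusion subcategory *)

Section Surjectivity.
Variables (k : fieldType) (gT : finGroupType) (C : fusion_subcategory k gT).
Local Notation D := (ddouble k gT).
Local Notation ddmod := (ddmod k gT).
Local Notation e g := (ddb k (g, 1%g)).
Implicit Types (U V W : ddmod) (g h x y z : gT).

(** Isolates one summand of the degree [g h] part of the tensor product. *)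
Lemma ddtens_proj V W g h x :
  (V (e g) *t W (e h)) *m ddtens V W (ddb k ((g * h)%g, x)) =
  V (ddb k (g, x)) *t W (ddb k (h, x)).
Proof.
rewrite /= ddtens_actb mulmx_sumr (bigD1 g) //= mulKg tensmx_mul -!ddactM.
rewrite !ddbMJ !conjg1 !eqxx !scale1r !mul1g big1 ?addr0 // => y yN.
by rewrite tensmx_mul -ddactM ddbMJ conjg1 eq_sym (negPf yN) scale0r linear0 tens0mx.
Qed.

(** Products come from tensor products, conjugates from the action of [x], which carries degree
    [g ^ x] to degree [g]; finiteness takes care of inverses. *)
Lemma ex_support_group : exists2 K : {group gT}, (K <| [set: gT])%g &
  forall g, g \in K <-> exists2 V, C V & V (e g) != 0.
Proof.
pose A := [set g | `[< exists2 V, C V & V (e g) != 0 >]].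
have AP g : g \in A <-> exists2 V, C V & V (e g) != 0.
  by rewrite inE; split=> [/asboolP | /asboolP].
have gA : group_set A.
  apply/group_setP; split.
    apply/AP; exists (dd1 k gT); first exact: fsub_unit.
    by rewrite /= /dd1_act ddcounitb eqxx oner_neq0.
  move=> g h /AP[V CV Vg] /AP[W CW Wh]; apply/AP.
  exists (ddtens V W); first exact: fsub_tens.
  apply: contraNneq (tensmx_neq0 Vg Wh) => VW0.
  by rewrite -ddtens_proj VW0 mulmx0.
exists (Group gA) => //=; apply/normalP; split; first exact: subsetT.
move=> x _; apply/eqP; rewrite eqEcard cardJg leqnn andbT.
apply/subsetP=> _ /imsetP[g /AP[V CV Vg] ->]; apply/AP; exists V => //.
apply: contraNneq Vg => Vgx.
by rewrite -(mulgV x) -ddbM_conj -[x^-1%g]mul1g -ddbMu !ddactM Vgx mul0mx mulmx0.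
Qed.

Lemma ex_kernel_group : exists2 H : {group gT}, (H <| [set: gT])%g &
  forall h, h \in H <-> forall V, C V -> V (ddb k (1%g, h)) = V (e 1%g).
Proof.
pose A := [set h | `[< forall V, C V -> V (ddb k (1%g, h)) = V (e 1%g) >]].
have AP h : h \in A <-> forall V, C V -> V (ddb k (1%g, h)) = V (e 1%g).
  by rewrite inE; split=> [/asboolP | /asboolP].
have b1M g h : ddb k (1%g, (g * h)%g) = ddb k (1%g, g) * ddb k (1%g, h).
  by rewrite ddbMJ conj1g eqxx scale1r.
have gA : group_set A.
  apply/group_setP; split; first exact/AP.
  move=> g h /AP Vg /AP Vh; apply/AP=> V CV.
  by rewrite b1M ddactM Vg // Vh // -ddactM -b1M mulg1.
exists (Group gA) => //=; apply/normalP; split; first exact: subsetT.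
move=> x _; apply/eqP; rewrite eqEcard cardJg leqnn andbT.
apply/subsetP=> _ /imsetP[h /AP Vh ->]; apply/AP=> V CV.
by rewrite conjgE !b1M !ddactM Vh // -!ddactM -!b1M mul1g mulVg.
Qed.

Variables K H : {group gT}.
Hypothesis nK : (K <| [set: gT])%g.
Hypothesis nH : (H <| [set: gT])%g.
Hypothesis KP : forall g, g \in K <-> exists2 V, C V & V (e g) != 0.
Hypothesis HP : forall h, h \in H <->
  forall V, C V -> V (ddb k (1%g, h)) = V (e 1%g).

(** [h] is trivial in degree 1 of [V (x) V^*]. Projecting to [V_g (x) (V_g)^*] gives
    [M (x) N^T = e g (x) (e g)^T], which is nonzero, so [M] is a multiple of [e g]. *)
Lemma support_scalar V g h : C V -> V (e g) != 0 -> h \in H ->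
  exists2 c, c != 0 & V (ddb k (g, h)) = c *: V (e g).
Proof.
move=> CV Vg Hh; have CVV := fsub_tens CV (fsub_dual CV).
have := congr1 (mulmx (V (e g) *t (dddual V) (e g^-1%g))) ((HP h).1 Hh _ CVV).
have proj x := ddtens_proj V (dddual V) g g^-1%g x.
rewrite mulgV in proj; rewrite !proj /= /dddual_act !ddantib !invgK invg1 mul1g mulg1.
set M := V (ddb k (g, h)); set N := V _ => MN.
have MNE i j l m : M i j * N l m = V (e g) i j * V (e g) l m.
  have := congr1 (fun X : 'M_(_, _) => X (mxtens_index (i, m)) (mxtens_index (j, l))) MN.
  by rewrite !tensmxE !mxE.
have /matrix0Pn[l [m Vlm]] := Vg.
have Nlm : N l m != 0.
  by apply: contraNneq (mulf_neq0 Vlm Vlm) => N0; rewrite -MNE N0 mulr0.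
exists (V (e g) l m / N l m); first by rewrite mulf_neq0 ?invr_eq0.
by apply/matrixP=> i j; rewrite !mxE -[M i j](mulfK Nlm) MNE -mulrA mulrC.
Qed.

(** On some [V], [ddb (g, h)] is a nonzero multiple of [e g], yet right multiplication by
    [e (g ^ h)] fixes it; this product is zero if [g ^ h] differs from [g]. *)
Lemma support_centralize g h : g \in K -> h \in H -> (g * h = h * g)%g.
Proof.
move=> /KP[V CV Vg] Hh; have [c c0 Vgh] := support_scalar CV Vg Hh.
apply/commgP; rewrite -conjg_fix; apply: contraTT Vg => ghN; rewrite negbK.
have : V (ddb k (g, h)) *m V (e (g ^ h)%g) = V (ddb k (g, h)).
  by rewrite -ddactM ddbM_conj mulg1.
rewrite Vgh -scalemxAl ddact_e eq_sym (negPf ghN) scale0r scaler0 => /esym/eqP.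
by rewrite scaler_eq0 (negPf c0).
Qed.

(** The scalar for the direct sum of [W] and [V] serves for both. *)
Lemma support_scalar_uniform g h : g \in K -> h \in H ->
  exists c, forall V, C V -> V (ddb k (g, h)) = c *: V (e g).
Proof.
move=> /KP[W CW Wg] Hh; have [c _ Wgh] := support_scalar CW Wg Hh.
exists c => V CV; have CWV := fsub_sum CW CV.
have [|c' _] := support_scalar CWV _ Hh (g := g).
  by apply: contraNneq Wg; rewrite /= /ddadd_act -block_mx0 => /eq_block_mx[->].
rewrite /= /ddadd_act scale_block_mx => /eq_block_mx[Wc' _ _ ->].
move/eqP: Wc'; rewrite Wgh -subr_eq0 -scalerBl scaler_eq0 (negPf Wg) orbF.
by rewrite subr_eq0 => /eqP->.
Qed.

(** [B] is nonzero since [h] is invertible, multiplicative in [g] by tensor products and in [h] by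
    composition, and invariant since [x] carries degree [g] to a conjugate degree. *)
Lemma ex_bichar_triple :
  exists t, [/\ bt_K t = K, bt_H t = H & forall V, C V -> bt_obj t V].
Proof.
have /fin_all_exists[b bP] : forall p : [subg K] * [subg H], exists c,
    forall V, C V -> V (ddb k (sgval p.1, sgval p.2)) = c *: V (e (sgval p.1)).
  by move=> p; apply: support_scalar_uniform; apply: subgP.
have bP' g h (Kg : g \in K) (Hh : h \in H) V : C V ->
    V (ddb k (g, h)) = b (subg K g, subg H h) *: V (e g).
  by move=> CV; have := bP (subg K g, subg H h) V CV; rewrite /= !subgK.
have cZ V g (c c' : k) : V (e g) != 0 -> c *: V (e g) = c' *: V (e g) -> c = c'.
  move=> Vg /eqP; rewrite -subr_eq0 -scalerBl scaler_eq0 (negPf Vg) orbF.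
  by rewrite subr_eq0 => /eqP.
have bchar : bicharacter [ffun p => b p].
  split=> [x y | x1 x2 y | x y1 y2]; rewrite !ffunE.
  - have /KP[V CV Vx] := subgP x; apply: contraNneq Vx => b0.
    have := bP (x, y) V CV; rewrite b0 scale0r /= => Vxy.
    by rewrite -[X in (_, X)](mulgV (sgval y)) -ddbM_conj ddactM Vxy mul0mx.
  - have /KP[V CV Vx] := subgP x1; have /KP[W CW Wx] := subgP x2.
    have CVW := fsub_tens CV CW.
    have := congr1 (mulmx (V (e (sgval x1)) *t W (e (sgval x2))))
      (bP ((x1 * x2)%g, y) _ CVW).
    rewrite /= -[ddtens_act V W]/(ddtens V W : _ -> _) -scalemxAr !ddtens_proj.
    rewrite (bP (x1, y)) // (bP (x2, y)) // tensmxZ => /eqP.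
    rewrite -subr_eq0 -scalerBl scaler_eq0 (negPf (tensmx_neq0 Vx Wx)) orbF.
    by rewrite subr_eq0 => /eqP->.
  - have /KP[V CV Vx] := subgP x; apply: (cZ V (sgval x)) => //.
    rewrite -(bP (x, (y1 * y2)%g)) //= -ddbMu ddactM (bP (x, y1)) // -scalemxAl.
    by rewrite -ddactM ddbMu mul1g (bP (x, y2)) // scalerA.
have binv : bichar_invariant [ffun p => b p].
  move=> x y z; rewrite !ffunE; have /KP[V CV Vy] := subgP y.
  have Ky : (sgval y ^ x^-1)%g \in K.
    by rewrite memJ_norm ?subgP // (subsetP (normal_norm nK)) ?inE.
  have Hz : (sgval z ^ x^-1)%g \in H.
    by rewrite memJ_norm ?subgP // (subsetP (normal_norm nH)) ?inE.
  have xJ (u : gT) : (x * u * x^-1 = u ^ x^-1)%g by rewrite conjgE invgK mulgA.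
  rewrite !xJ; apply: (cZ V (sgval y)) => //.
  rewrite -(bP (y, z)) //=.
  have uJ (u : gT) : V (ddb k (sgval y, u)) =
     V (ddu k x^-1%g) *m V (ddb k ((sgval y ^ x^-1)%g, (u ^ x^-1)%g)) *m V (ddu k x).
    by rewrite -!ddactM dduMb ddbMu invgK conjgKV conjgE invgK !mulgA mulVg mul1g mulgKV.
  by rewrite !uJ conj1g (bP' _ _ Ky Hz) // -scalemxAr -scalemxAl.
exists (BicharTriple nK nH support_centralize bchar binv).
split=> // V CV; split=> [g|g h Kg Hh] /=.
  by move=> Kg; apply: contraNeq Kg => Vg; apply/KP; exists V.
by rewrite bP' // /bt_val ffunE.
Qed.
End Surjectivity.

(** * Matrix coefficients, and generation of all objects of a triple *)

Section Generation.
Variables (k : fieldType) (gT : finGroupType) (C : fusion_subcategory k gT).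
Hypothesis char0 : [pchar k] =i pred0.
Local Notation D := (ddouble k gT).
Local Notation ddmod := (ddmod k gT).
Local Notation e g := (ddb k (g, 1%g)).
Implicit Types (U V W : ddmod) (g h x y z : gT) (f : gT -> k).

Definition coefficient g f : Prop := exists2 U, C U &
  exists (l : 'rV_(dddim U)) (v : 'cV_(dddim U)),
    forall x, f x = (l *m U (ddb k (g, x)) *m v) 0 0.

Lemma coefficient_entry V g i j : C V -> coefficient g (fun x => V (ddb k (g, x)) i j).
Proof.
move=> CV; exists V => //; exists (delta_mx 0 i), (delta_mx j 0) => x.
by rewrite -rowE -colE !mxE.
Qed.

Lemma coefficient_const c : coefficient 1%g (fun=> c).
Proof.
exists (dd1 k gT); first exact: fsub_unit.
exists 1%:M, c%:M => x.
by rewrite /= /dd1_act ddcounitb eqxx !mul1mx mxE eqxx.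
Qed.

Lemma coefficientD g f f' : coefficient g f -> coefficient g f' ->
  coefficient g (fun x => f x + f' x).
Proof.
move=> [U CU [l [v fE]]] [U' CU' [l' [v' fE']]].
exists (ddadd U U'); first exact: fsub_sum.
exists (row_mx l l'), (col_mx v v') => x.
by rewrite /= /ddadd_act mul_row_block !mulmx0 addr0 add0r mul_row_col fE fE' [RHS]mxE.
Qed.

Lemma coefficientM g g' f f' : coefficient g f -> coefficient g' f' ->
  coefficient (g * g')%g (fun x => f x * f' x).
Proof.
move=> [U CU [l [v fE]]] [U' CU' [l' [v' fE']]].
exists (ddtens U U'); first exact: fsub_tens.
(* Without the projections, other summands of degree [g g'] would contribute. *)
exists ((l *t l') *m (U (e g) *t U' (e g'))), (v *t v') => x.
rewrite -[X in X *m _]mulmxA ddtens_proj fE fE'.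
set A := U _; set A' := U' _.
have /matrixP/(_ 0 0) : (l *t l') *m (A *t A') *m (v *t v') =
    (l *m A *m v) *t (l' *m A' *m v') by rewrite !tensmx_mul.
by move=> ->; rewrite [RHS]mxE !ord1.
Qed.

Variable t : bichar_triple k gT.
Local Notation K := (bt_K t).
Local Notation H := (bt_H t).
Local Notation B := (bt_val t).
Hypothesis KP : forall g, g \in K -> exists2 V, C V & V (e g) != 0.
Hypothesis HP : forall h, (forall V, C V -> V (ddb k (1%g, h)) = V (e 1%g)) -> h \in H.
Hypothesis Ct : forall V, C V -> bt_obj t V.

(** Some matrix entry in degree 1 takes distinct values at [1] and [h]; an affine change makes them
    [1] and [0]. *)
Lemma coefficient_separate h : h \notin H ->
  exists f, [/\ coefficient 1%g f, forall x, x \in H -> f x = 1 & f h = 0].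
Proof.
move=> HhN; have [V CV Vh] : exists2 V, C V & V (ddb k (1%g, h)) != V (e 1%g).
  apply: contrapT => noV; case/negP: HhN; apply: HP => V CV.
  by apply/eqP; apply: contrapT => /negP Vh; apply: noV; exists V.
have {Vh} /matrix0Pn[i [j]] : V (e 1%g) - V (ddb k (1%g, h)) != 0.
  by rewrite subr_eq0 eq_sym.
pose f x := V (ddb k (1%g, x)) i j.
rewrite !mxE -[X in X - _]/(f 1%g) -[X in _ - X]/(f h) => d0.
exists (fun x => (f 1%g - f h)^-1 * (f x - f h)); split.
- rewrite -[1%g](mulg1 1%g); apply: coefficientM; first exact: coefficient_const.
  by apply: coefficientD; [apply: coefficient_entry | apply: coefficient_const].
- move=> x Hx; have [_ VB] := Ct CV.
  have -> : f x = f 1%g by rewrite /f VB // bt_val1l scale1r.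
  by rewrite mulVf.
- by rewrite subrr mulr0.
Qed.

(** The product of separating functions over all [h] outside [H]. *)
Lemma coefficient_indicator :
  exists2 f, coefficient 1%g f & forall x, f x = (x \in H)%:R.
Proof.
suff [f [fc f1 f0]] : exists f, [/\ coefficient 1%g f,
    forall x, x \in H -> f x = 1 & forall x, x \in enum gT -> x \notin H -> f x = 0].
  exists f => // x; have [Hx|Hx] := boolP (x \in H); first by rewrite f1.
  by rewrite f0 ?mem_enum.
elim: (enum gT) => [|h s [f [fc f1 f0]]].
  by exists (fun=> 1); split => //; apply: coefficient_const.
have [Hh|Hh] := boolP (h \in H).
  exists f; split=> // x; rewrite inE => /predU1P[-> /negP|] //; exact: f0.
have [f' [fc' f1' f0']] := coefficient_separate Hh.
exists (fun x => f' x * f x); split=> [|x Hx|x].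
- by rewrite -[1%g](mulg1 1%g); apply: coefficientM.
- by rewrite f1 ?f1' // mulr1.
- rewrite inE => /predU1P[-> _|sx Hx]; first by rewrite f0' mul0r.
  by rewrite f0 // mulr0.
Qed.

(** An entry of [V (ddb (g, x))] that is nonzero at [x = 1], divided by its value there, is [B g x]
    on [H]; the indicator of [H] kills the rest. *)
Lemma coefficient_bt_val g : g \in K ->
  exists2 f, coefficient g f & forall x, f x = if x \in H then B g x else 0.
Proof.
move=> Kg; have [V CV /matrix0Pn[i [j Vij]]] := KP Kg.
have [f fc fE] := coefficient_indicator.
exists (fun x => V (ddb k (g, x)) i j * (f x * (V (e g) i j)^-1)).
  have := coefficientM (coefficient_entry g i j CV)
    (coefficientM fc (coefficient_const (V (e g) i j)^-1)).
  by rewrite !mulg1.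
move=> x; rewrite fE; case: ifP => Hx; last by rewrite mul0r mulr0.
have [_ VB] := Ct CV.
by rewrite VB // mxE mul1r mulfK.
Qed.

Lemma graded_rank1 V W g (v : 'cV_(dddim W)) (l : 'rV_(dddim V)) :
  W (e g) *m v = v -> l *m V (e g) = l ->
  forall a, (v *m l) *m V (e a) = W (e a) *m (v *m l).
Proof.
move=> vg lg a; rewrite -mulmxA -lg -mulmxA ddact_e -vg [W (e a) *m _]mulmxA.
rewrite [X in _ = X *m _]mulmxA ddact_e eq_sym.
by case: eqP => [->|_]; rewrite ?scale1r // !scale0r !(mulmx0, mul0mx).
Qed.

Lemma ddavg_rank1_factors V g (v : 'cV_(dddim V)) (l : 'rV_(dddim V)) :
  bt_obj t V -> g \in K -> V (e g) *m v = v -> l *m V (e g) = l ->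
  factors C (ddavg (v *m l)).
Proof.
move=> [_ VB] Kg vg lg.
have [f [Z CZ [l' [w' fE]]] fB] := coefficient_bt_val Kg.
pose w := Z (e g) *m w'; pose p := l' *m Z (e g).
have wg : Z (e g) *m w = w by rewrite mulmxA ddact_e eqxx scale1r.
have pg : p *m Z (e g) = p by rewrite -mulmxA ddact_e eqxx scale1r.
have puw x : p *m Z (ddu k x) *m w = (f x)%:M.
  have -> : p *m Z (ddu k x) *m w = l' *m Z (ddb k (g, x) * e g) *m w'.
    by rewrite /p /w -[x in RHS]mul1g -ddbMu !ddactM !mulmxA.
  rewrite ddbMJ mulg1 linearZ /= -scalemxAr -scalemxAl [_ *m w']mx11_scalar -fE.
  (* If [x] does not commute with [g], the left side is zero; such an [x] is outside [H], where [f]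
     vanishes too. *)
  case: eqP => [_|gx]; first by rewrite scale1r.
  rewrite fB scale0r; case: ifP => [Hx|_]; last by rewrite raddf0.
  by case: gx; rewrite (bt_fixJ Kg Hx).
clearbody w p.
have lu x : x \in H -> l *m V (ddu k x^-1%g) = B g x^-1%g *: l.
  by move=> Hx; rewrite -{1}lg -mulmxA -ddactM ddbMu mul1g VB ?groupV // -scalemxAr lg.
suff -> : ddavg (v *m l) =
    #|H|%:R^-1 *: (ddavg (v *m p) *m ddavg (w *m l)) :> 'M_(dddim V).
  apply: factorsZ; exists Z => //; exists (ddavg (w *m l)), (ddavg (v *m p)).
  by split=> //; apply: ddavg_hom; apply: (graded_rank1 (g := g)).
rewrite mulmx_suml scaler_sumr; apply: eq_bigr => x _.
(* With [x y] as the second group element, the middle becomes [p y w = f y]. *)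
rewrite mulmx_sumr (reindex_inj (mulgI x)) /=.
have -> : \sum_y V (ddu k x) *m (v *m p) *m Z (ddu k x^-1%g) *m
      (Z (ddu k (x * y)%g) *m (w *m l) *m V (ddu k (x * y)^-1%g)) =
    \sum_y f y *: (V (ddu k x) *m v *m (l *m V (ddu k y^-1%g)) *m V (ddu k x^-1%g)).
  have ZK : Z (ddu k x^-1%g) *m Z (ddu k x) = 1%:M by rewrite -{2}[x]invgK ddact_uK.
  apply: eq_bigr => y _; rewrite invMg -!dduM !ddactM !mulmxA.
  rewrite -(mulmxA _ _ (Z (ddu k x))) ZK mulmx1.
  rewrite -(mulmxA _ p) -(mulmxA _ (p *m _) w) puw.
  by rewrite mul_mx_scalar -!scalemxAl.
rewrite (bigID [in H]) /= [X in _ + X]big1 ?addr0 => [|y /negPf Hy]; last first.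
  by rewrite fB Hy scale0r.
(* On [H] the scalars [f y = B g y] and [B g y^-1] cancel, so the [|H|] terms agree. *)
rewrite (eq_bigr (fun=> V (ddu k x) *m (v *m l) *m V (ddu k x^-1%g))) => [|y Hy].
  by rewrite sumr_const -scaler_nat scalerA mulVf ?natG_neq0 // scale1r.
rewrite lu // fB Hy -scalemxAr -scalemxAl scalerA mulrC bt_valVr // scale1r.
by rewrite !mulmxA.
Qed.

Lemma bt_obj_generated V : bt_obj t V -> C V.
Proof.
move=> tV; have [V0 _] := tV; apply: factors_id.
have GN0 : #|gT|%:R != 0 :> k by rewrite -cardsT natG_neq0.
(* The identity is its own average over [G], and [e g = e g *m e g] is the sum over [i] of column
   [i] times row [i], a graded rank one map. *)
suff -> : 1%:M = #|gT|%:R^-1 *: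
    \sum_g \sum_i ddavg (col i (V (e g)) *m row i (V (e g))) :> 'M_(dddim V).
  apply/factorsZ/factors_sum => g; apply: factors_sum => i.
  have [Kg|Kg] := boolP (g \in K).
    apply: (ddavg_rank1_factors (g := g)) => //.
    - by rewrite colE mulmxA ddact_e eqxx scale1r.
    - by rewrite rowE -mulmxA ddact_e eqxx scale1r.
  suff -> : ddavg (col i (V (e g)) *m row i (V (e g))) = 0 :> 'M_(dddim V).
    exact: factors0.
  by apply: big1 => x _; rewrite V0 // col0 mul0mx mulmx0 mul0mx.
transitivity (#|gT|%:R^-1 *: ddavg (1%:M : 'M_(dddim V))).
  rewrite /ddavg (eq_bigr (fun=> 1%:M)) => [|x _]; last by rewrite mulmx1 ddact_uK.
  by rewrite sumr_const -scaler_nat scalerA mulVf ?scale1r.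
congr (_ *: _); under [RHS]eq_bigr => g _ do rewrite exchange_big.
rewrite exchange_big; apply: eq_bigr => x _ /=.
rewrite -{1}ddact_sum_e mulmx_sumr mulmx_suml; apply: eq_bigr => g _.
rewrite -mulmx_suml -mulmx_sumr; congr (_ *m _ *m _).
transitivity (V (e g) *m V (e g)); first by rewrite ddact_e eqxx scale1r.
apply/matrixP=> i j; rewrite mxE summxE; apply: eq_bigr => l _.
by rewrite mxE big_ord1 !mxE.
Qed.

End Generation.

(** * The bijection *)

(** By extensionality of predicates and proof irrelevance. *)
Lemma fsub_eq (k : fieldType) (gT : finGroupType) (C C' : fusion_subcategory k gT) :
  (forall V, C V <-> C' V) -> C = C'.
Proof.
case: C C' => [o o1 o2 o3 o4 o5 o6] [o' o1' o2' o3' o4' o5' o6'] /= oo'.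
have eo : o = o' by apply/predeqP.
by subst o'; congr FusionSubcategory; apply: Prop_irrelevance.
Qed.

Lemma bt_fsub_surj (k : fieldType) (gT : finGroupType) (char0 : [pchar k] =i pred0)
  (C : fusion_subcategory k gT) : exists t, bt_fsub t = C.
Proof.
have [K nK KP] := ex_support_group C; have [H nH HP] := ex_kernel_group C.
have [t [tK tH Ct]] := ex_bichar_triple nK nH KP HP; exists t.
apply: fsub_eq => V; split; last exact: Ct.
apply: bt_obj_generated => // [g | h]; first by rewrite tK => /KP.
by rewrite tH => Vh; apply/HP.
Qed.

Theorem theorem1p1 (gT : finGroupType) (k : closedFieldType)
    (char0 : [pchar k] =i pred0) :
  exists F : fusion_subcategory k gT -> bichar_triple k gT, bijective F.
Proof.
(* [F] chooses preimages under [bt_fsub]; injectivity makes it a two-sided inverse. *)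
have [F FK] := choice (bt_fsub_surj (gT := gT) char0).
by exists F; exists (@bt_fsub k gT) => // t; apply: (bt_fsub_inj char0).
Qed.
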